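(* If a $k$-translatable groupoid $Q$ of order $n$ is left unitary, then $Q$ is (a) bookend if and only if $[k^2]_n=[2k]_n=n-1$; (b) elastic if and only if $[k^2+k]_n=0$; (c) left distributive if and only if $[k^2]_n=0$; (d) left modular if and only if $k=n-1$; (e) right modular if and only if $[k^2]_n=1$; (f) paramedial if and only if $[k^2]_n=1$.
   Context: A groupoid is a set with a binary operation $\cdot$. For an integer $x$, $[x]_n$ denotes the residue of $x$ modulo $n$, represented in $\{1,\ldots,n\}$, with $0$ identified with $n$ ($[x]_n=0$ means $n\mid x$). All groupoids are finite and taken to be of the form $Q=\{1,\ldots,n\}$ with the natural ordering. For $1\le k<n$, $Q$ is $k$-translatable if in its multiplication table each row $i$, $2\le i\le n$, is obtained from row $i-1$ by cyclically shifting it $k$ places to the right, i.e. $i\cdot j=(i-1)\cdot[j-k]_n$ for all $j$ and all $2\le i\le n$. It is left unitary if $1$ is a left neutral element, i.e. $1\cdot x=x$ for all $x$. A groupoid $Q$ is: bookend if $(j\cdot i)\cdot(i\cdot j)=i$; elastic if $i\cdot(j\cdot i)=(i\cdot j)\cdot i$; left distributive if $i\cdot(j\cdot z)=(i\cdot j)\cdot(i\cdot z)$; left modular if $(i\cdot j)\cdot z=(z\cdot j)\cdot i$; right modular if $i\cdot(j\cdot z)=z\cdot(j\cdot i)$; paramedial if $(i\cdot j)\cdot(w\cdot z)=(z\cdot j)\cdot(w\cdot i)$; in each case for all $i,j,w,z\in Q$.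
   Formalization: The names are interchanged: here left modular means i·(j·z)=z·(j·i) and right modular means (i·j)·z=(z·j)·i; with the paper's definitions as given, (d) and (e) fail, e.g. for n=3, k=1, i·j=[j-i+1]_3. *)

(* Defs.v *)
From mathcomp Require Import all_boot all_order all_algebra.

Set Implicit Arguments.
Unset Strict Implicit.
Unset Printing Implicit Defensive.

Import GRing.Theory.

Definition carrier (n : nat) := {i : nat | 0 < i <= n}.

(* [x]_n for n > 0, with representatives 1, ..., n: the remainder 0 is
   represented by n. *)
Definition residue (n : nat) (x : int) : nat :=
  let r := `|(x %% n%:Z)%Z|%N in if r == 0 then n else r.

(* i . j = (i - 1) . [j - k]_n for all j and all 2 <= i <= n; here i' and j'
   are the elements i - 1 and [j - k]_n. *)
Definition translatable (n k : nat) (op : carrier n -> carrier n -> carrier n) :=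
  forall i i' j j' : carrier n,
    val i = (val i').+1 ->
    val j' = residue n ((val j)%:Z - k%:Z)%R ->
    op i j = op i' j'.

Definition left_unitary (n : nat) (op : carrier n -> carrier n -> carrier n) :=
  forall e x : carrier n, val e = 1 -> op e x = x.

Section Identities.
Variables (Q : Type) (op : Q -> Q -> Q).
Local Notation "x * y" := (op x y).

Definition bookend := forall i j, (j * i) * (i * j) = i.

Definition elastic := forall i j, i * (j * i) = (i * j) * i.

(* Self-distributivity; not ssrfun's left_distributive. *)
Definition left_self_distributive :=
  forall i j z, i * (j * z) = (i * j) * (i * z).

(* Sources differ on which of the next two laws is called left and which right
   modular.  With the Abel-Grassmann law (ij)z = (zj)i as right modular, a left
   unitary k-translatable groupoid is left modular iff k = n - 1 and right
   modular iff [k^2]_n = 1; exchanging the two names makes both equivalences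
   fail (e.g. n = 3, k = 1). *)
Definition left_modular := forall i j z, i * (j * z) = z * (j * i).

Definition right_modular := forall i j z, (i * j) * z = (z * j) * i.

Definition paramedial :=
  forall i j w z, (i * j) * (w * z) = (z * j) * (w * i).

End Identities.

(* Main.v *)
Require Import Defs.
From mathcomp Require Import all_boot all_order all_algebra.
From mathcomp Require Import ring.

(** A left unitary k-translatable groupoid is the ring Z/n in disguise.  Send
    the element i to the class of i - 1: the left neutral element 1 goes to 0,
    and going down one row subtracts k from every product, so the operation
    becomes x . y = y - k x ([coord_op]).  All six identities are then
    identities between linear forms over Z/n.  Such an identity holds
    everywhere as soon as it holds when one variable is 1 and the others are
    0, which gives one equation in k per variable; these equations are the
    conditions on k (section [LinearOperation]).  What remains is to read an
    equation in Z/n as a statement on residues ([residue_eqP],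
    [dvdz_intr_eq0]). *)

Import GRing.Theory.

Section LinearOperation.

Set Implicit Arguments.
Unset Strict Implicit.
Local Open Scope ring_scope.

Variables (R : comNzRingType) (Q : Type) (op : Q -> Q -> Q).
Variables (a : R) (f : Q -> R) (g : R -> Q).
Hypotheses (fK : cancel f g) (gK : cancel g f).
Hypothesis f_op : forall x y, f (op x y) = f y - a * f x.

Let f_inj : injective f := can_inj fK.

(** The left side is (1 + a^2) j - 2 a i, to be compared with i. *)
Lemma bookend_linear : bookend op <-> a ^+ 2 = -1 /\ 2 * a = -1.
Proof.
split=> [law | [a2 aa] i j].
  have := congr1 f (law (g 0) (g 1)); have := congr1 f (law (g 1) (g 0)).
  rewrite !f_op !gK => e1 e0; split.
    rewrite -[RHS]add0r -e0; ring.
  rewrite -[in RHS]e1; ring.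
apply: f_inj; rewrite !f_op.
have ->: f j - a * f i - a * (f i - a * f j)
  = f j + a ^+ 2 * f j - (2 * a) * f i by ring.
rewrite a2 aa; ring.
Qed.

(** The two sides differ by (a^2 + a) i. *)
Lemma elastic_linear : elastic op <-> a ^+ 2 + a = 0.
Proof.
split=> [law | aa i j].
  have := congr1 f (law (g 1) (g 0)); rewrite !f_op !gK => /eqP.
  rewrite eq_sym -subr_eq0 => /eqP <-; ring.
apply: f_inj; apply/eqP; rewrite eq_sym -subr_eq0 !f_op; apply/eqP.
transitivity ((a ^+ 2 + a) * f i); first by ring.
by rewrite aa mul0r.
Qed.

(** The two sides differ by a^2 i. *)
Lemma left_self_distributive_linear :
  left_self_distributive op <-> a ^+ 2 = 0.
Proof.
split=> [law | aa i j z].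
  have := congr1 f (law (g 1) (g 0) (g 0)); rewrite !f_op !gK => /eqP.
  rewrite eq_sym -subr_eq0 => /eqP <-; ring.
apply: f_inj; apply/eqP; rewrite eq_sym -subr_eq0 !f_op; apply/eqP.
transitivity (a ^+ 2 * f i); first by ring.
by rewrite aa mul0r.
Qed.

(** The two sides differ by (a + 1) (z - i). *)
Lemma left_modular_linear : left_modular op <-> a = -1.
Proof.
split=> [law | a_opp1 i j z].
  have := congr1 f (law (g 0) (g 0) (g 1)); rewrite !f_op !gK => /eqP.
  rewrite -subr_eq0 => /eqP e; rewrite -[RHS]add0r -e; ring.
by apply: f_inj; rewrite !f_op a_opp1; ring.
Qed.

(** The two sides differ by (a^2 - 1) (i - z). *)
Lemma right_modular_linear : right_modular op <-> a ^+ 2 = 1.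
Proof.
split=> [law | aa i j z].
  have := congr1 f (law (g 1) (g 0) (g 0)); rewrite !f_op !gK => /eqP.
  rewrite -subr_eq0 => /eqP e; rewrite -[RHS]add0r -e; ring.
apply: f_inj; apply/eqP; rewrite -subr_eq0 !f_op; apply/eqP.
transitivity ((a ^+ 2 - 1) * (f i - f z)); first by ring.
by rewrite aa subrr mul0r.
Qed.

(** Again the two sides differ by (a^2 - 1) (i - z). *)
Lemma paramedial_linear : paramedial op <-> a ^+ 2 = 1.
Proof.
split=> [law | aa i j w z].
  have := congr1 f (law (g 1) (g 0) (g 0) (g 0)); rewrite !f_op !gK => /eqP.
  rewrite -subr_eq0 => /eqP e; rewrite -[RHS]add0r -e; ring.
apply: f_inj; apply/eqP; rewrite -subr_eq0 !f_op; apply/eqP.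
transitivity ((a ^+ 2 - 1) * (f i - f z)); first by ring.
by rewrite aa subrr mul0r.
Qed.

End LinearOperation.

Section Residues.

Set Implicit Arguments.
Unset Strict Implicit.
Local Open Scope ring_scope.

Variable n : nat.
Hypothesis n_gt1 : (1 < n)%N.

Lemma intr_modz (z : int) : (`|(z %% n%:Z)%Z|%N)%:R = z%:~R :> 'Z_n.
Proof.
have n0 : n%:Z != 0 by rewrite eqz_nat -lt0n ltnW.
rewrite [in RHS](divz_eq z n) intrD intrM -[n%:~R]/(n%:R) pchar_Zp // mulr0 add0r.
by rewrite -[in RHS](gez0_abs (modz_ge0 z n0)).
Qed.

Lemma dvdz_intr_eq0 (z : int) : (n%:Z %| z)%Z <-> z%:~R = 0 :> 'Z_n.
Proof.
have n0 : n%:Z != 0 by rewrite eqz_nat -lt0n ltnW.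
have lt_zn : (`|(z %% n%:Z)%Z| < n)%N.
  by rewrite -ltz_nat (gez0_abs (modz_ge0 z n0)) ltz_mod.
rewrite -intr_modz; split=> [/dvdz_mod0P -> // | /(congr1 val)].
rewrite /= val_Zp_nat // modn_small // => /eqP.
by rewrite absz_eq0 => /eqP /dvdz_mod0P.
Qed.

Lemma residueK (z : int) : (residue n z)%:R = z%:~R :> 'Z_n.
Proof.
rewrite -intr_modz /residue; case: eqP => // ->.
by rewrite pchar_Zp.
Qed.

Lemma residue_bounds (z : int) : (0 < residue n z <= n)%N.
Proof.
have n0 : n%:Z != 0 by rewrite eqz_nat -lt0n ltnW.
rewrite /residue; case: eqP => [_ | /eqP]; first by rewrite ltnW /=.
rewrite -lt0n => -> /=; apply: ltnW.
by rewrite -ltz_nat (gez0_abs (modz_ge0 z n0)) ltz_mod.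
Qed.

Lemma natr_Zp_inj (r s : nat) :
  (0 < r <= n)%N -> (0 < s <= n)%N -> r%:R = s%:R :> 'Z_n -> r = s.
Proof.
move=> /andP[r0 rn] /andP[s0 sn] /(congr1 val); rewrite /= !val_Zp_nat //.
case: (ltngtP r n) rn => [rn _|//|-> _]; case: (ltngtP s n) sn => [sn _|//|-> _].
- by rewrite !modn_small.
- by rewrite modnn modn_small // => e; rewrite e in r0.
- by rewrite modnn modn_small // => e; rewrite -e in s0.
by [].
Qed.

Lemma residue_eqP (z : int) (r : nat) :
  (0 < r <= n)%N -> residue n z = r <-> z%:~R = r%:R :> 'Z_n.
Proof.
move=> r_bounds; rewrite -residueK; split=> [-> //|].
exact: natr_Zp_inj (residue_bounds z) r_bounds.
Qed.

Lemma natr_predn : (n - 1)%:R = -1 :> 'Z_n.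
Proof. by rewrite natrB ?pchar_Zp ?sub0r // ltnW. Qed.

End Residues.

Section Coordinate.

Set Implicit Arguments.
Unset Strict Implicit.
Local Open Scope ring_scope.

Variable n : nat.
Hypothesis n_gt1 : (1 < n)%N.

(** The shift by one puts the left neutral element at 0. *)
Definition coord (i : carrier n) : 'Z_n := (val i)%:R - 1.

Definition of_coord (x : 'Z_n) : carrier n :=
  exist _ (residue n (val x).+1) (residue_bounds n_gt1 _).

Lemma of_coordK : cancel of_coord coord.
Proof. by move=> x; rewrite /coord (residueK n_gt1) -pmulrn -natr1 addrK natr_Zp. Qed.

Lemma coordK : cancel coord of_coord.
Proof.
move=> i; apply: val_inj; apply: (natr_Zp_inj n_gt1).
- exact: valP (of_coord _).
- exact: valP i.
by apply: (addIr (-1)); exact: of_coordK.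
Qed.

(** Induction on the row: row 1 is the identity, where [coord] vanishes, and
    passing to the next row adds 1 to [coord] of the row and subtracts k from
    the column in which the product is read off. *)
Lemma coord_op (k : nat) (op : carrier n -> carrier n -> carrier n) :
  translatable k op -> left_unitary op ->
  forall x y, coord (op x y) = coord y - k%:R * coord x.
Proof.
move=> op_translatable op_unit [m m_bounds].
elim: m m_bounds => [//|[|m] IHm] m_bounds y.
  by rewrite op_unit // /coord /= subrr mulr0 subr0.
have m_bounds' : (0 < m.+1 <= n)%N by case/andP: m_bounds => _ /ltnW.
pose y' : carrier n :=
  exist (fun i => 0 < i <= n)%N _ (residue_bounds n_gt1 ((val y)%:Z - k%:Z)).
pose x' : carrier n := exist (fun i => 0 < i <= n)%N _ m_bounds'.
rewrite (op_translatable _ x' y y') // IHm.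
rewrite /coord /= (residueK n_gt1) intrB -[m.+2%:R]natr1 /=; ring.
Qed.

End Coordinate.

Theorem theorem3p5 (n k : nat) (op : carrier n -> carrier n -> carrier n)
    (k_bounds : 1 <= k < n)
    (op_translatable : translatable k op)
    (op_left_unitary : left_unitary op) :
  (bookend op <->
     residue n (k%:Z ^+ 2)%R = n - 1 /\ residue n (2 * k%:Z)%R = n - 1) /\
  (elastic op <-> (n%:Z %| (k%:Z ^+ 2 + k%:Z)%R)%Z) /\
  (left_self_distributive op <-> (n%:Z %| (k%:Z ^+ 2)%R)%Z) /\
  (left_modular op <-> k = n - 1) /\
  (right_modular op <-> residue n (k%:Z ^+ 2)%R = 1) /\
  (paramedial op <-> residue n (k%:Z ^+ 2)%R = 1).
Proof.
have n_gt1 : 1 < n by case/andP: k_bounds => k_gt0 /(leq_ltn_trans k_gt0).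
have k_range : 0 < k <= n by case/andP: k_bounds => -> /ltnW.
have pred_range : 0 < n - 1 <= n by rewrite subn_gt0 n_gt1 leq_subr.
have one_range : 0 < 1 <= n by exact: ltnW.
have op_lin := coord_op n_gt1 op_translatable op_left_unitary.
have cK := @coordK n n_gt1; have gK := @of_coordK n n_gt1.
have sqE : (k%:Z ^+ 2)%:~R%R = (k%:R ^+ 2)%R :> 'Z_n by rewrite rmorphXn.
split; last split; last split; last split; last split.
- rewrite (bookend_linear cK gK op_lin) !(residue_eqP n_gt1) //.
  by rewrite sqE intrM natr_predn.
- by rewrite (elastic_linear cK gK op_lin) (dvdz_intr_eq0 n_gt1) intrD sqE.
- by rewrite (left_self_distributive_linear cK gK op_lin) (dvdz_intr_eq0 n_gt1)
    sqE.
- rewrite (left_modular_linear cK gK op_lin) -(natr_predn n_gt1).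
  by split=> [|-> //]; exact: natr_Zp_inj.
- by rewrite (right_modular_linear cK gK op_lin) (residue_eqP n_gt1) // sqE.
- by rewrite (paramedial_linear cK gK op_lin) (residue_eqP n_gt1) // sqE.
Qed.
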